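(* Let $n\ge3$ be an integer. The SDS map $[C_n,(1+\mathrm{parity})_3,\mathrm{id}]\colon\mathbb F_2^n\to\mathbb F_2^n$ has a fixed point if and only if $4$ divides $n$.
   Context: $C_n$ is the cycle graph with vertices $v_1,\dots,v_n$, $v_i$ adjacent to $v_j$ iff $i-j\equiv\pm1\pmod n$. $(1+\mathrm{parity})_3(x,y,z)=1+x+y+z$ over $\mathbb F_2$. For $x=(x_1,\dots,x_n)\in\mathbb F_2^n$, the local update $F_{v_i}$ replaces $x_i$ by $1+x_{i-1}+x_i+x_{i+1}$ (indices mod $n$) and leaves other coordinates unchanged; the SDS map with identity update order is $[C_n,(1+\mathrm{parity})_3,\mathrm{id}]=F_{v_n}\circ\cdots\circ F_{v_1}$. *)

(* Defs.v *)
From mathcomp Require Import all_boot all_order all_algebra.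
Set Implicit Arguments.
Unset Strict Implicit.
Unset Printing Implicit Defensive.
Import GRing.Theory.
Local Open Scope ring_scope.

(* The vertex v_k of the cycle graph C_n is the ordinal k - 1 of 'I_n. *)
Definition cycle_graph (n : nat) : rel 'I_n :=
  fun i j => (i == j.+1 %[mod n])%N || (j == i.+1 %[mod n])%N.

(* For n >= 3 the closed neighbourhood of a vertex i of C_n consists of the
   three distinct vertices i - 1, i, i + 1, with indices taken mod n. *)
Lemma cycle_graph_nbhd (n : nat) (i : 'I_n) : (2 < n)%N ->
  perm_eq [:: ord_pred i; i; ordS i]
          (enum [pred j | (j == i) || cycle_graph i j]).
Proof.
move=> n_gt2.
have neq_addn (j : 'I_n) k : (0 < k < n)%N -> ((j + k) %% n)%N != j.
  move=> /andP[k_gt0 ltkn]; apply/negP => /eqP eq_jk.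
  have /eqP : (j + k = j + 0 %[mod n])%N by rewrite addn0 -[in RHS]eq_jk modn_mod.
  by rewrite eqn_modDl mod0n modn_small // eqn0Ngt k_gt0.
have neqS (j : 'I_n) : ordS j != j.
  by rewrite -val_eqE /= -addn1; apply: neq_addn; apply: ltnW.
have neqSS (j : 'I_n) : ordS (ordS j) != j.
  by rewrite -val_eqE /= -addn1 modnDml addn1 -addn2; apply: neq_addn.
apply: uniq_perm; last 1 first.
- move=> j; rewrite !inE mem_enum !inE /cycle_graph.
  have -> : (i == j.+1 %[mod n])%N = (j == ord_pred i).
    rewrite -(inj_eq (@ordS_inj n) j) ord_predK eq_sym -val_eqE /=.
    by rewrite (modn_small (ltn_ord i)).
  have -> : (j == i.+1 %[mod n])%N = (j == ordS i).
    by rewrite -val_eqE /= (modn_small (ltn_ord j)).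
  by rewrite orbCA.
- rewrite /= !inE negb_or (eq_sym i (ordS i)) neqS !andbT.
  rewrite -(inj_eq (@ordS_inj n) (ord_pred i) i).
  rewrite -(inj_eq (@ordS_inj n) (ord_pred i) (ordS i)) ord_predK.
  by rewrite eq_sym neqS eq_sym neqSS.
- exact: enum_uniq.
Qed.

Definition one_plus_parity3 (x y z : 'F_2) : 'F_2 := 1 + x + y + z.

Definition local_update (n : nat) (f : 'F_2 -> 'F_2 -> 'F_2 -> 'F_2)
    (i : 'I_n) (x : 'rV['F_2]_n) : 'rV['F_2]_n :=
  \row_j (if j == i then f (x 0 (ord_pred i)) (x 0 i) (x 0 (ordS i))
          else x 0 j).

(* The SDS map [C_n, f, w]: the vertices are updated one at a time, in the
   order in which they are listed in w, the head of w first. *)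
Definition sds_map (n : nat) (f : 'F_2 -> 'F_2 -> 'F_2 -> 'F_2)
    (w : seq 'I_n) (x : 'rV['F_2]_n) : 'rV['F_2]_n :=
  foldl (fun y i => local_update f i y) x w.

(* Main.v *)
(** A fixed point of a composition in which every vertex is updated exactly
    once is a common fixed point of the local updates, so the fixed points are
    the solutions of [x (i + 2) = 1 + x i], indices mod [n].  Going twice around
    the cycle adds [n] to a coordinate, so [n] is even; then going once around
    in [n / 2] steps adds [n / 2], which is therefore even as well.  Conversely
    [x i = i %/ 2] is a solution when [4] divides [n]. *)
Require Import Defs.
From mathcomp Require Import all_boot all_order all_algebra.
From mathcomp Require Import zify.

Import GRing.Theory.
Local Open Scope ring_scope.

Section FixedPoints.

Variables (n : nat) (f : 'F_2 -> 'F_2 -> 'F_2 -> 'F_2).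
Implicit Types (i j : 'I_n) (w : seq 'I_n) (x : 'rV['F_2]_n).

Lemma sds_map_notin w x j : j \notin w -> sds_map f w x 0 j = x 0 j.
Proof.
elim: w x => [|i w IHw] x //=; rewrite inE negb_or => /andP[neq_ji jNw].
by rewrite [LHS]IHw // mxE (negPf neq_ji).
Qed.

Lemma local_update_fixP i x :
  local_update f i x = x <->
  f (x 0 (ord_pred i)) (x 0 i) (x 0 (ordS i)) = x 0 i.
Proof.
split=> [/rowP/(_ i) | fix_i]; first by rewrite mxE eqxx.
by apply/rowP=> j; rewrite mxE; case: eqP => // ->.
Qed.

(** As [i] does not recur in the rest of [w], later updates keep the coordinate that the first one
    gives it. So if the composition fixes [x], the first update already does, and induction handles
    the rest. *)
Lemma sds_map_fixP w x : uniq w ->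
  (sds_map f w x = x <-> forall i, i \in w -> local_update f i x = x).
Proof.
elim: w => [|i w IHw] //= /andP[iNw uniq_w]; split=> [fix_x | fix_x].
  have fix_i : local_update f i x = x.
    apply/local_update_fixP; have := sds_map_notin w (local_update f i x) i iNw.
    by rewrite [sds_map _ _ _]fix_x mxE eqxx => <-.
  have fix_w : sds_map f w x = x by rewrite -[in RHS]fix_x /= fix_i.
  by move=> j; rewrite inE => /predU1P[-> // | ]; apply: (IHw uniq_w).1.
rewrite /sds_map /= fix_x ?mem_head //; apply: (IHw uniq_w).2 => j jw.
by rewrite fix_x // inE jw orbT.
Qed.

End FixedPoints.

Lemma natr_F2_eq0 (m : nat) : (m%:R == 0 :> 'F_2) = ~~ odd m.
Proof. by rewrite -(dvdn_pcharf (pchar_Fp (isT : prime 2))) dvdn2. Qed.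

(** The terms [b] cancel, leaving [1 + a + c = 0], and signs do not matter in characteristic 2. *)
Lemma one_plus_parity3_fixP (a b c : 'F_2) :
  one_plus_parity3 a b c = b <-> c = 1 + a.
Proof.
have oppF2 (z : 'F_2) : - z = z by apply: oppr_pchar2; apply: pchar_Fp.
rewrite /one_plus_parity3 addrAC -[b in _ = b]add0r; split=> [/addIr/eqP | ->].
  by rewrite addr_eq0 oppF2 => /eqP->.
by rewrite -[X in _ + X + _]oppF2 subrr.
Qed.

Lemma sds_parity3_fixP (n : nat) (x : 'rV['F_2]_n) :
  sds_map one_plus_parity3 (enum 'I_n) x = x <->
  forall i, x 0 (ordS (ordS i)) = 1 + x 0 i.
Proof.
rewrite sds_map_fixP ?enum_uniq //; split=> [fix_x i | fix_x i _].
  (* The condition at the middle vertex [ordS i] links its two neighbours. *)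
  have /local_update_fixP/one_plus_parity3_fixP := fix_x (ordS i) (mem_enum _ _).
  by rewrite ordSK.
apply/local_update_fixP/one_plus_parity3_fixP.
by rewrite -fix_x ord_predK.
Qed.

Theorem theorem4p12 (n : nat) (n_ge3 : (3 <= n)%N) :
  (exists x : 'rV['F_2]_n, sds_map one_plus_parity3 (enum 'I_n) x = x)
  <-> (4 %| n)%N.
Proof.
split=> [[x /sds_parity3_fixP fix_x] | n4].
  have n_gt0 : (0 < n)%N by apply: leq_trans n_ge3.
  pose i0 := Ordinal n_gt0.
  have iterS m : x 0 (iter m.*2 (@ordS n) i0) = m%:R + x 0 i0.
    elim: m => [|m IHm]; first by rewrite add0r.
    by rewrite doubleS !iterS fix_x IHm addrA nat1r.
  have val_iterS m : val (iter m (@ordS n) i0) = (m %% n)%N.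
    elim: m => [|m IHm]; first by rewrite mod0n.
    by rewrite /= IHm -addn1 modnDml addn1.
  (* A closed walk of [m.*2] steps from [i0] forces [m = 0] in ['F_2]. Used for [m = n], two turns,
     then for [m = n./2], one turn. *)
  have even_turn m : (n %| m.*2)%N -> ~~ odd m.
    move=> /eqP m0; rewrite -natr_F2_eq0; apply/eqP/(addIr (x 0 i0)).
    by rewrite -iterS add0r; congr (x 0 _); apply: val_inj; rewrite val_iterS.
  have n_even : ~~ odd n by apply: even_turn; rewrite -muln2 dvdn_mulr.
  have := even_turn n./2; rewrite even_halfK // => /(_ (dvdnn n)).
  lia.
exists (\row_i (i./2)%:R); apply/sds_parity3_fixP => i.
rewrite !mxE /= -[(i.+1 %% n).+1]addn1 modnDml addn1.
(* Wrapping around is harmless: a multiple of [n] is a multiple of 4, so its half is even. *)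
have -> (k : nat) : ((k %% n)./2)%:R = (k./2)%:R :> 'F_2.
  rewrite [in RHS](divn_eq k n); have /dvdnP[q ->] := n4.
  have -> : (k %/ (q * 4) * (q * 4) = (k %/ (q * 4) * q).*2.*2)%N by lia.
  rewrite halfD odd_double add0n doubleK natrD -muln2 natrM.
  by rewrite (_ : 2%:R = 0 :> 'F_2) ?mulr0 ?add0r //; apply/eqP.
by rewrite /= nat1r.
Qed.
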